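(* Let $(\Omega,\mathcal A,\mu)$ be a $\sigma$-finite measure space and $K\in(0,\mu(\Omega))$. Let $X$ be a reflexive Banach space that is compactly embedded in $L^1(\Omega)$, let $f:X\to\overline{\mathbb R}$ be proper, lower semicontinuous, convex, bounded from below and coercive, and suppose there is $u_0\in X$ with $f(u_0)<\infty$ and $\|u_0\|_0\le K$. Then the $L^0$-constrained problem $$\min_{u\in X}f(u)\quad\text{subject to}\quad\|u\|_0\le K$$ has a global solution.
   Context: $\|u\|_0:=\mu(\{x\in\Omega\mid u(x)\ne0\})$. $f$ is proper if $f>-\infty$ everywhere and $f(u)<\infty$ for some $u$; $f$ is coercive if $\|u_n\|_X\to\infty$ implies $f(u_n)\to\infty$ for every sequence $(u_n)\subseteq X$. *)

(* Defs.v *)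
From HB Require Import structures.
From mathcomp Require Import all_boot all_order all_algebra.
From mathcomp Require Import all_classical all_reals all_analysis.

Set Implicit Arguments.
Unset Strict Implicit.
Unset Printing Implicit Defensive.

Import Order.TTheory GRing.Theory Num.Theory.
Import numFieldNormedType.Exports.

Local Open Scope classical_set_scope.
Local Open Scope ring_scope.

Section dual.
Context {R : realType} {X : normedModType R}.

Definition dual_pred : {pred X -> R^o} :=
  fun l => `[< linear l /\ continuous l >].

Lemma dual_submod_closed : submod_closed dual_pred.
Proof.
split.
  apply/asboolP; split; last exact: cst_continuous.
  by move=> a x y; rewrite -[RHS]/(a *: 0 + 0) scaler0 addr0.
move=> a f g /asboolP[lf cf] /asboolP[lg cg]; apply/asboolP; split.
  move=> b x y; rewrite !fctE lf lg !scalerDr !scalerA (mulrC a b).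
  by rewrite -!addrA; congr (_ + _); rewrite addrCA.
by move=> x; apply: cvgD; [apply: cvgZl_tmp; exact: cf|exact: cg].
Qed.

HB.instance Definition _ :=
  GRing.isSubmodClosed.Build R (X -> R^o) dual_pred dual_submod_closed.

End dual.

Record dual {R : realType} (X : normedModType R) : Type := Dual {
  dual_fun :> X -> R^o ;
  dual_funP : dual_fun \in @dual_pred R X }.

Section dual_normed_module.
Context {R : realType} {X : normedModType R}.
Local Notation X' := (dual X).
Implicit Types l : X'.

HB.instance Definition _ := [isSub for @dual_fun R X].
HB.instance Definition _ := [Choice of X' by <:].
HB.instance Definition _ := [SubChoice_isSubLmodule of X' by <:].

Lemma dual_linear l : linear l.
Proof. by have /asboolP[] := dual_funP l. Qed.

HB.instance Definition _ l :=
  GRing.isLinear.Build R X R^o *:%R (dual_fun l) (dual_linear l).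

Lemma dual_continuous l : continuous l.
Proof. by have /asboolP[] := dual_funP l. Qed.

Definition dual_norm l : R := sup [set `|l x| | x in [set x | `|x| <= 1]].

Let has_sup_dual l : has_sup [set `|l x| | x in [set x | `|x| <= 1]].
Proof.
split; first by exists `|l 0|, 0; rewrite //= normr0.
have /(@linear_boundedP _ _ _ l)/pinfty_ex_gt0[M M0 lM] :=
  @continuous_linear_bounded _ _ _ 0 l (@dual_continuous l 0).
exists M => _ [x x1 <-]; apply: (le_trans (lM x)).
by rewrite ler_piMr// ltW.
Qed.

Let dual_norm_ub l x : `|x| <= 1 -> `|l x| <= dual_norm l.
Proof. by move=> x1; apply: ub_le_sup; [case: (has_sup_dual l)|exists x]. Qed.

Let dual_norm_lub l M : (forall x, `|x| <= 1 -> `|l x| <= M) ->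
  dual_norm l <= M.
Proof.
by move=> lM; apply: ge_sup; [case: (has_sup_dual l)|move=> _ [x /lM ? <-]].
Qed.

Lemma dual_normP l x : `|l x| <= dual_norm l * `|x|.
Proof.
have [->|x0] := eqVneq x 0; first by rewrite linear0 !normr0 mulr0.
rewrite -ler_pdivrMr ?normr_gt0// mulrC.
rewrite -[X in X * _](@ger0_norm _ `|x|^-1) ?invr_ge0//.
rewrite -[X in X <= _]normrZ -linearZ; apply: dual_norm_ub.
by rewrite normrZ ger0_norm ?invr_ge0// mulVf ?normr_eq0.
Qed.

Lemma ler_dual_normD l1 l2 : dual_norm (l1 + l2) <= dual_norm l1 + dual_norm l2.
Proof.
apply: dual_norm_lub => x x1; apply: (le_trans (ler_normD (l1 x) (l2 x))).
by rewrite lerD// dual_norm_ub.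
Qed.

Lemma dual_norm_eq0 l : dual_norm l = 0 -> l = 0.
Proof.
move=> l0; apply/val_inj/funext => x /=.
by apply/eqP; rewrite -normr_le0 (le_trans (dual_normP l x))// l0 mul0r.
Qed.

Lemma dual_normZ a l : dual_norm (a *: l) = `|a| * dual_norm l.
Proof.
have le b k : dual_norm (b *: k) <= `|b| * dual_norm k.
  apply: dual_norm_lub => x x1; rewrite [leLHS](_ : _ = `|b| * `|k x|).
    by rewrite ler_wpM2l// dual_norm_ub.
  exact: normrZ.
apply/eqP; rewrite eq_le le /=.
have [->|a0] := eqVneq a 0.
  rewrite normr0 mul0r; apply: le_trans (dual_norm_ub _ (x := 0) _) => //.
  by rewrite normr0.
rewrite -ler_pdivlMl ?normr_gt0// -normfV.
by rewrite -[X in dual_norm X <= _](scalerK a0) le.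
Qed.

HB.instance Definition _ := Lmodule_isNormed.Build R X'
  ler_dual_normD dual_normZ dual_norm_eq0.

End dual_normed_module.

Definition reflexive_space {R : realType} (X : normedModType R) : Prop :=
  forall Phi : dual (dual X), exists x : X, forall l : dual X, Phi l = l x.

Section compact_embedding.
Context {d : measure_display} {T : measurableType d} {R : realType}.
Variables (mu : {measure set T -> \bar R}) (X : normedModType R).
Implicit Type iota : X -> LspaceType1 mu.

Definition L1fun (v : LspaceType1 mu) : T -> R := v.

Lemma L1_eqP (v w : LspaceType1 mu) : L1fun v = L1fun w %[ae mu] <-> v = w.
Proof.
split=> [vw|->]; last exact: ae_eq_refl.
have : (v : {mfun_ mu, T >-> measurableTypeR R}) = w.
  by rewrite -[LHS]reprK -[RHS]reprK; apply/eqmodP/asboolP.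
case: v w {vw} => v [[pv]] [w [[pw]]] /= vw; subst w.
by rewrite (Prop_irrelevance pv pw).
Qed.

(* [LspaceType1 mu] is the set of a.e. classes without a module structure, so
   operations on it are expressed on representatives. *)
Definition linear_into_L1 iota := forall (a : R) (u v : X),
  L1fun (iota (a *: u + v)) = a \*: L1fun (iota u) \+ L1fun (iota v) %[ae mu].

Definition continuous_into_L1 iota := exists C : R,
  forall u : X, ('N[mu]_1[EFin \o L1fun (iota u)] <= (C * `|u|)%:E)%E.

Definition compact_into_L1 iota := forall u : X^nat,
  (exists M : R, forall n, `|u n| <= M) ->
  exists (phi : nat -> nat) (v : LspaceType1 mu), increasing_seq phi /\
    'N[mu]_1[EFin \o (L1fun (iota (u (phi n))) \- L1fun v)%R]%E
      @[n --> \oo] --> 0%E.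

Definition compact_embedding_L1 iota : Prop :=
  [/\ linear_into_L1 iota, injective iota,
      continuous_into_L1 iota & compact_into_L1 iota].

Definition L0norm (v : LspaceType1 mu) : \bar R :=
  mu [set x | L1fun v x != 0].

End compact_embedding.

Section extended_functional.
Context {R : realType} {X : normedModType R}.
Implicit Type f : X -> \bar R.
Local Open Scope ereal_scope.

Definition proper_fun f := (forall u, -oo < f u) /\ (exists u, f u < +oo).

(* [t] ranges over the open interval to avoid the convention [0 * +oo = 0]. *)
Definition convex_efun f := forall (u v : X) (t : R), (0 < t < 1)%R ->
  f (t *: u + (1 - t) *: v)%R <= t%:E * f u + (1 - t)%:E * f v.

Definition bounded_below f := exists m : R, forall u, m%:E <= f u.

Definition coercive f := forall u : X^nat,
  (`|u n|%R @[n --> \oo] --> +oo%R) -> f (u n) @[n --> \oo] --> +oo.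

Definition global_solution f (C : set X) (u : X) :=
  C u /\ forall v, C v -> f u <= f v.

End extended_functional.

(* Main.v *)
(** Nested convex sets replace weakly convergent subsequences. Along a
    bounded minimizing sequence, compactness gives a subsequence [w_n] with
    [iota w_n --> v] in [L^1]. The sets of [x] with
    [f x <= inf f + 1/n], [|iota x - v|_1 <= 1/n] and [|x| <= M] are convex,
    bounded, nonempty and decreasing, so by reflexivity their closures share a
    point [x] (Smulian). Then [f x <= inf f] by lower semicontinuity, and
    [iota w_n --> iota x] in [L^1], whence [|x|_0 <= K] by Markov's inequality
    on the level sets [|iota x| >= e].

    Smulian's property follows from the bidual definition of reflexivity: the
    limit along an ultrafilter of [l |-> l (x_n)] is a bounded functional on the
    dual, hence evaluation at a point, and Hahn-Banach separation puts that
    point in every closure. *)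
From HB Require Import structures.
Require Import Defs.
From mathcomp Require Import all_boot all_order all_algebra.
From mathcomp Require Import all_classical all_reals all_analysis.
From mathcomp Require Import measurable_realfun.
From mathcomp Require Import ring lra.

Import Order.TTheory GRing.Theory Num.Theory.
Import numFieldNormedType.Exports.

Local Open Scope classical_set_scope.
Local Open Scope ring_scope.

(** * Sublinear functionals and the Hahn-Banach theorem *)

Definition sublinear {R : realType} {V : lmodType R} (p : V -> R) : Prop :=
  (forall x y, p (x + y) <= p x + p y) /\
  (forall t x, 0 <= t -> p (t *: x) <= t * p x).

Section sublinear_theory.
Context {R : realType} {V : lmodType R}.
Implicit Types (p q : V -> R) (x y : V) (t : R).

Lemma sublinear0 p : sublinear p -> p 0 = 0.
Proof.
move=> [pD pZ]; apply/eqP; rewrite eq_le.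
have := pZ 0 0 (lexx 0); rewrite scale0r mul0r => ->/=.
by have := pD 0 0; rewrite addr0; lra.
Qed.

Lemma sublinear_oppl p x : sublinear p -> - p (- x) <= p x.
Proof.
move=> sp; have [pD _] := sp.
by have := pD x (- x); rewrite subrr sublinear0//; lra.
Qed.

(** The reverse inequality is that of [sublinear] for [t^-1] at [t *: x]; for infima only one
    inequality thus has to be checked. *)
Lemma sublinearZ p t x : sublinear p -> 0 <= t -> p (t *: x) = t * p x.
Proof.
move=> sp t0; have [_ pZ] := sp; apply/eqP; rewrite eq_le pZ//=.
have [->|tn0] := eqVneq t 0; first by rewrite scale0r mul0r sublinear0.
have tgt0 : 0 < t by rewrite lt_def tn0.
have := pZ t^-1 (t *: x); rewrite scalerA mulVf// scale1r invr_ge0 => /(_ t0).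
by rewrite ler_pdivlMl.
Qed.

Lemma le_inf_add (A B : set R) c : A !=set0 -> B !=set0 ->
  (forall a b, A a -> B b -> c <= a + b) -> c <= inf A + inf B.
Proof.
move=> A0 B0 cAB; rewrite -lerBlDr; apply: lb_le_inf => // a Aa.
rewrite lerBlDr -lerBlDl; apply: lb_le_inf => // b Bb.
by rewrite lerBlDl cAB.
Qed.

(** The [q i] need not be sublinear, since each inequality may pass to another index [k]. This
    serves chains in Zorn's lemma as well as infima over directions; the condition at [0] settles
    the scalar [t = 0]. *)
Lemma sublinear_inf (I : Type) (F : I -> Prop) (q : I -> V -> R) :
  (exists i, F i) ->
  (forall x, has_lbound [set q i x | i in F]) ->
  (forall i j x y, F i -> F j ->
    exists2 k, F k & q k (x + y) <= q i x + q j y) ->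
  (forall i t x, F i -> 0 < t ->
    exists2 k, F k & q k (t *: x) <= t * q i x) ->
  (forall e : R, 0 < e -> exists2 k, F k & q k 0 <= e) ->
  sublinear (fun x => inf [set q i x | i in F]).
Proof.
move=> [i0 Fi0] lbq qD qZ q0.
have ne x : [set q i x | i in F] !=set0 by exists (q i0 x), i0.
have le i x : F i -> inf [set q i x | i in F] <= q i x.
  by move=> Fi; apply: ge_inf => //; exists i.
split=> [x y|t x].
  apply: le_inf_add => // _ _ [i Fi <-] [j Fj <-].
  by have [k Fk kij] := qD i j x y Fi Fj; apply: le_trans kij; exact: le.
rewrite le_eqVlt => /predU1P[<-|t0].
  rewrite scale0r mul0r; apply/ler_addgt0Pl => e e0; rewrite addr0.
  by have [k Fk ke] := q0 e e0; apply: le_trans ke; exact: le.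
rewrite -ler_pdivrMl//; apply: lb_le_inf => // _ [i Fi <-].
rewrite ler_pdivrMl//; have [k Fk ki] := qZ i t x Fi t0.
by apply: le_trans ki; exact: le.
Qed.

(** Zorn's lemma for the reversed pointwise order. A nonempty chain is bounded by its pointwise
    infimum, which is finite since every sublinear [q] below [p] satisfies [- p (- x) <= q x]. *)
Lemma sublinear_minimal p : sublinear p ->
  exists q, [/\ sublinear q, forall x, q x <= p x &
    forall q', sublinear q' -> (forall x, q' x <= q x) -> q' = q].
Proof.
move=> sp.
pose S := {q : V -> R | sublinear q /\ forall x, q x <= p x}.
pose le (a b : S) : bool := `[< forall x, sval b x <= sval a x >].
have [|a b c /asboolP ab /asboolP bc
  |[a pa] [b pb] /asboolP ab /asboolP ba|A totA|] := @Zorn S le.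
- by move=> a; apply/asboolP.
- by apply/asboolP => x; apply: le_trans (ab x).
- have E : a = b by apply/funext => x; apply/eqP; rewrite eq_le ab ba.
  by subst b; congr exist; exact: Prop_irrelevance.
- have [->|/set0P[a0 Aa0]] := eqVneq A set0.
    by exists (exist _ p (conj sp (fun x => lexx (p x)))).
  have lb x : has_lbound [set sval a x | a in A].
    exists (- p (- x)) => _ [[a [sa ap]] Aa <-] /=.
    by apply: le_trans (sublinear_oppl a x sa); rewrite lerN2.
  have sub : sublinear (fun x => inf [set sval a x | a in A]).
    apply: sublinear_inf => //.
    + by exists a0.
    + move=> a b x y Aa Ab; have [/asboolP ab|/asboolP ba] := totA _ _ Aa Ab.
      * exists b => //; have [[bD _] _] := svalP b.
        by apply: le_trans (bD _ _) _; rewrite lerD2r.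
      * exists a => //; have [[aD _] _] := svalP a.
        by apply: le_trans (aD _ _) _; rewrite lerD2l.
    + move=> a t x Aa t0; exists a => //.
      by have [[_ aZ] _] := svalP a; apply/aZ/ltW.
    + move=> e e0; exists a0 => //; have [sa _] := svalP a0.
      by rewrite sublinear0// ltW.
  have subp x : inf [set sval a x | a in A] <= p x.
    have [_ ap] := svalP a0; apply: le_trans (ap x).
    by apply: ge_inf => //; exists a0.
  have inS : sublinear (fun x => inf [set sval a x | a in A]) /\
    forall x, inf [set sval a x | a in A] <= p x by [].
  exists (exist (fun q : V -> R => sublinear q /\ forall x, q x <= p x) _ inS).
  move=> a Aa; apply/asboolP => x /=.
  by apply: ge_inf => //; exists a.
- move=> [q [sq qp]] qmin; exists q; split=> // q' sq' q'q.
  have q'p x : q' x <= p x by apply: le_trans (qp x).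
  have := qmin (exist _ q' (conj sq' q'p)).
  rewrite /le => /(_ (asboolT _)) => /(_ q'q).
  by move/(congr1 sval).
Qed.

(* Comparing a minimal [q] with its directional modification
   [x |-> inf_(t >= 0) (q (x + t y) - t q y)] yields [q x + q y <= q (x + y)]. *)
Lemma hahn_banach p : sublinear p ->
  exists l : V -> R, linear (l : V -> R^o) /\ forall x, l x <= p x.
Proof.
move=> /sublinear_minimal[q [sq qp qmin]]; have [qD qZ] := sq.
have qaddr x y : q (x + y) = q x + q y.
  apply/eqP; rewrite eq_le qD/=.
  pose Q t x := q (x + t *: y) - t * q y.
  have lbQ z : has_lbound [set Q t z | t in [set t | 0 <= t]].
    exists (- q (- z)) => _ [t /= t0 <-]; rewrite /Q -sublinearZ//.
    by have := qD (z + t *: y) (- z); rewrite addrAC subrr add0r; lra.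
  have sub : sublinear (fun z => inf [set Q t z | t in [set t | 0 <= t]]).
    apply: sublinear_inf => //.
    - by exists 0 => /=.
    - move=> t s a b /= t0 s0; exists (t + s); first by rewrite /= addr_ge0.
      rewrite /Q scalerDl addrACA mulrDl.
      by have := qD (a + t *: y) (b + s *: y); lra.
    - move=> t s a /= t0 s0; exists (s * t); first by rewrite /= mulr_ge0// ltW.
      by rewrite /Q -scalerA -scalerDr (sublinearZ q s _ sq (ltW s0)) mulrBr mulrA.
    - move=> e e0; exists 0 => //=.
      by rewrite /Q scale0r addr0 mul0r subr0 sublinear0// ltW.
  have E : (fun z => inf [set Q t z | t in [set t | 0 <= t]]) = q.
    apply: qmin => // z; apply: ge_inf => //; exists 0 => //=.
    by rewrite /Q scale0r addr0 mul0r subr0.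
  have : q x <= Q 1 x.
    by rewrite -[in leLHS]E; apply: ge_inf => //; exists 1 => //=.
  by rewrite /Q scale1r mul1r lerBrDr.
have qN x : q (- x) = - q x.
  by apply/eqP; rewrite -subr_eq0 opprK -qaddr addNr sublinear0.
exists q; split=> // a x y; rewrite qaddr; congr (_ + _).
have [a0|a0] := leP 0 a; first exact: sublinearZ.
rewrite -[in LHS](opprK a) scaleNr qN sublinearZ ?oppr_ge0 1?ltW//.
by rewrite mulNr opprK.
Qed.

End sublinear_theory.

(** * Separation of a point from a convex set *)

Definition convex_subset {R : realType} {V : lmodType R} (C : set V) : Prop :=
  forall x y t, 0 < t < 1 -> C x -> C y -> C (t *: x + (1 - t) *: y).

Section separation.
Context {R : realType} {X : normedModType R}.

Lemma dual_bounded_linear (l : X -> R) (M : R) : linear (l : X -> R^o) ->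
  (forall x, `|l x| <= M * `|x|) -> exists L : dual X, forall x, L x = l x.
Proof.
move=> ll lM.
pose lin := GRing.isLinear.Build R X R^o *:%R (l : X -> R^o) ll.
pose l' : {linear X -> R^o} := HB.pack (l : X -> R^o) lin.
have cl : continuous (l : X -> R^o).
  apply: (linear_bounded_continuous l').1.
  apply/linear_boundedP; near=> r => x; apply: le_trans (lM x) _.
  by rewrite ler_wpM2r//; near: r; exact: nbhs_pinfty_ge.
have dl : (l : X -> R^o) \in @dual_pred R X by apply/asboolP.
by exists (Dual dl).
Unshelve. all: by end_near. Qed.

(* [r <= |c - x|] on [C] makes [y |-> inf (|y + t (c - x)| - t r)], over
   [t >= 0] and [c \in C], a finite sublinear functional below the norm; it is at
   most [- r] at [x - c], so any linear functional below it separates. *)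
Lemma hahn_banach_separation (C : set X) (x : X) (r : R) : convex_subset C ->
  C !=set0 -> 0 < r -> (forall c, C c -> r <= `|c - x|) ->
  exists l : dual X, forall c, C c -> l x + r <= l c.
Proof.
move=> cC [c0 Cc0] r0 rC.
pose q (tc : R * X) (y : X) := `|y + tc.1 *: (tc.2 - x)| - tc.1 * r.
pose F (tc : R * X) := 0 <= tc.1 /\ C tc.2.
have lbq y : has_lbound [set q i y | i in F].
  exists (- `|y|) => _ [[t c] [/= t0 Cc] <-]; rewrite /q/=.
  have : t * r <= `|t *: (c - x)| by rewrite normrZ ger0_norm// ler_wpM2l// rC.
  have := ler_normB (y + t *: (c - x)) y; rewrite addrAC subrr add0r.
  by lra.
have sub : sublinear (fun y => inf [set q i y | i in F]).
  apply: sublinear_inf => //.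
  - by exists (0, c0).
  - move=> [t c] [s e] y z [/= t0 Cc] [/= s0 Ce].
    (* For [t = s = 0] the weights used below have a zero denominator; the index [(0, c0)] does
       instead. *)
    have [ts0|tsN0] := eqVneq (t + s) 0.
      exists (0, c0) => //; rewrite /q/= scale0r.
      have -> : t = 0 by lra.
      have -> : s = 0 by lra.
      by rewrite !scale0r !addr0 !mul0r !subr0 ler_normD.
    have tsp : 0 < t + s by lra.
    (* The weighted mean for which [(t + s) *: (g - x) = t *: (c - x) + s *: (e - x)]. Zero weights
       are split off because [convex_subset] covers only [0 < t < 1]. *)
    pose g := (t / (t + s)) *: c + (s / (t + s)) *: e.
    have Cg : C g.
      have [t00|tN0] := eqVneq t 0.
        by rewrite /g t00 mul0r scale0r !add0r divff ?scale1r//; lra.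
      have [s00|sN0] := eqVneq s 0.
        by rewrite /g s00 mul0r scale0r !addr0 divff ?scale1r//; lra.
      rewrite /g (_ : s / (t + s) = 1 - t / (t + s)); last first.
        by rewrite -[X in X - _](divff tsN0) -mulrBl addrAC subrr add0r.
      apply: cC => //; apply/andP; split; first by rewrite divr_gt0// lt_def tN0.
      by rewrite ltr_pdivrMr// mul1r ltrDl lt_def sN0.
    exists (t + s, g); first by split => //=; exact: ltW.
    rewrite /q/=.
    have -> : (t + s) *: (g - x) = t *: (c - x) + s *: (e - x).
      rewrite !scalerBr /g scalerDr !scalerA ![(t + s) * _]mulrC !divfK//.
      by rewrite scalerDl opprD addrACA.
    rewrite addrACA mulrDl.
    by have := ler_normD (y + t *: (c - x)) (z + s *: (e - x)); lra.
  - move=> [t c] s y [/= t0 Cc] s0; exists (s * t, c).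
      by split=> //=; rewrite mulr_ge0// ltW.
    rewrite /q/= -scalerA -scalerDr normrZ (gtr0_norm s0) mulrBr mulrA.
    by [].
  - move=> e e0; exists (0, c0) => //.
    by rewrite /q/= scale0r addr0 normr0 mul0r subrr ltW.
have [l [ll lp]] := hahn_banach _ sub.
have lle i y : F i -> l y <= q i y.
  by move=> Fi; apply: le_trans (lp y) _; apply: ge_inf => //; exists i.
have lN y : l (- y) = - l y.
  by have := ll (-1) y 0; rewrite scaleN1r addr0 => ->; have := ll (-1) 0 0;
    rewrite scaleN1r oppr0 addr0 !scaleN1r; lra.
have lB y z : l (y - z) = l y - l z.
  by have := ll 1 y (- z); rewrite !scale1r lN.
have l1 y : `|l y| <= 1 * `|y|.
  have le1 z : l z <= `|z|.
    apply: le_trans (lle (0, c0) z _) _ => //.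
    by rewrite /q/= scale0r addr0 mul0r subr0.
  by rewrite mul1r ler_norml le1 andbT lerNl -lN (le_trans (le1 _))// normrN.
have [L Ll] := dual_bounded_linear l 1 ll l1.
exists L => c Cc; rewrite !Ll.
(* At [x - c] the index [(1, c)] gives the value [- r]. *)
have := lle (1, c) (x - c) (conj ler01 Cc).
by rewrite /q/= scale1r mul1r subrKA subrr normr0 lB; lra.
Qed.

End separation.

(** * Nested bounded convex sets in a reflexive space *)

Section smulian.
Context {R : realType} {X : normedModType R}.

(* A weak limit of [x_ n \in K n] along an ultrafilter lies in every [K n]. *)
Lemma smulian (K : nat -> set X) (M : R) : reflexive_space X ->
  (forall n, convex_subset (K n)) -> (forall n, K n !=set0) ->
  (forall m n, (m <= n)%N -> K n `<=` K m) ->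
  (forall x, K 0%N x -> `|x| <= M) ->
  exists x, forall n, closure (K n) x.
Proof.
move=> refl cK neK decK bK.
have [x_ xK] := choice neK.
have [G [GU GE]] := ultraFilterLemma (@eventually_filter).
have GP : ProperFilter G by exact: ultra_proper.
have Phi_ex (l : dual X) : exists c : R, `|c| <= `|l| * M /\
    forall e : R, 0 < e -> G [set n | `|l (x_ n) - c| < e].
  have lx n : `|l (x_ n)| <= `|l| * M.
    apply: le_trans (dual_normP l _) _; apply: ler_wpM2l.
      exact: (normr_ge0 l).
    by apply: bK; apply: decK (xK n).
  have [|c [/= cI cc]] := @segment_compact R (- (`|l| * M)) (`|l| * M)
      ((fun n => (l (x_ n) : R)) @ G) _.
    by apply: (@filterE _ G) => n /=; rewrite in_itv/= -ler_norml.
  exists c; split; first by move: cI; rewrite /= in_itv/= -ler_norml.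
  move=> e e0; set S := [set n | _].
  (* A cluster point of an ultrafilter is a limit: if the complement of [S] were in [G], some point
     would lie both inside and outside [ball c e]. *)
  have GSC : G S \/ G (~` S) by exact: in_ultra_setVsetC.
  case: GSC => [//|GS].
  have [|y [/= yS yb]] := cc (~` ball c e) (ball c e) (_ : G _)
    (nbhsx_ballx c e e0); last by [].
  by apply: (filterS _ GS) => n /=; rewrite -ball_normE /= distrC.
have [Phi PhiP] := choice Phi_ex.
(* Uniqueness of limits along [G] reduces linearity of [Phi] to a limit computation. *)
have Phi_uniq (l : dual X) (c : R) :
    (forall e : R, 0 < e -> G [set n | `|l (x_ n) - c| < e]) -> Phi l = c.
  move=> lc; apply/eqP; rewrite -subr_eq0 -normr_le0; apply/ler_addgt0Pl => e e0.
  rewrite addr0; have e2 : 0 < e / 2 by rewrite divr_gt0.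
  have [n [/= n1 n2]] := filter_ex (filterI ((PhiP l).2 _ e2) (lc _ e2)).
  have := ler_distD (l (x_ n) : R) (Phi l) c; rewrite (distrC (Phi l) (l _)) => h.
  by apply: le_trans h _; rewrite [leRHS]splitr lerD// ltW.
have Phi_lin : linear (Phi : dual X -> R^o).
  move=> a l1 l2; apply: Phi_uniq => e e0.
  (* The [+ 1] keeps the denominator positive when [a = 0]. *)
  have ea : 0 < e / (2 * (`|a| + 1)) by rewrite divr_gt0// mulr_gt0// ltr_wpDl.
  have e2 : 0 < e / 2 by rewrite divr_gt0.
  apply: filterS (filterI ((PhiP l1).2 _ ea) ((PhiP l2).2 _ e2)) => n [/= n1 n2].
  have -> : (a *: l1 + l2 : dual X) (x_ n) - (a *: (Phi l1 : R^o) + Phi l2) =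
      a * (l1 (x_ n) - Phi l1) + (l2 (x_ n) - Phi l2).
    rewrite [LHS](_ : _ = a * l1 (x_ n) + l2 (x_ n) - (a * Phi l1 + Phi l2))//.
    by ring.
  apply: le_lt_trans (ler_normD _ _) _; rewrite normrM.
  have : `|a| * `|l1 (x_ n) - Phi l1| <= e / 2.
    apply: le_trans (_ : (`|a| + 1) * (e / (2 * (`|a| + 1))) <= _).
      by apply: ler_pM => //; [rewrite lerDl|exact: ltW].
    have a1 : `|a| + 1 != 0 by rewrite gt_eqF// ltr_wpDl.
    by rewrite [leLHS](_ : _ = e / 2)//; field.
  lra.
have [|F FP] := dual_bounded_linear Phi M Phi_lin.
  by move=> l; rewrite mulrC; exact: (PhiP l).1.
have [x xP] := refl F; exists x => n.
apply: contrapT => nx.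
have [e e0 eK] : exists2 e, 0 < e & forall c, K n c -> e <= `|c - x|.
  apply: contrapT => ne; apply: nx => B /nbhs_ballP[e /= e0 eB].
  apply: contrapT => KB; apply: ne; exists e => // c Kc.
  rewrite leNgt; apply/negP => cx; apply: KB; exists c; split=> //; apply: eB.
  by rewrite -ball_normE/= distrC.
have [l lP] := hahn_banach_separation _ x e (cK n) (neK n) e0 eK.
(* [G] contains every tail, so some [x_ k] in [K n] has [l (x_ k)] within [e] of [Phi l = l x],
   against the gap [e] given by separation. *)
have Gn : G [set k | (n <= k)%N] by apply: GE; exact: nbhs_infty_ge.
have [k [/= nk kl]] := filter_ex (filterI Gn ((PhiP l).2 _ e0)).
have := lP (x_ k) (decK _ _ nk _ (xK k)).
by rewrite -xP FP => h; move: kl; rewrite ltr_norml; lra.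
Qed.

End smulian.

(** * [L^1] distances and lower semicontinuity of the measure of the support *)

Section L1_distance.
Context {d : measure_display} {T : measurableType d} {R : realType}.
Context (mu : {measure set T -> \bar R}).
Implicit Types g h k : T -> R.

Lemma measurable_norm_ge g (e : R) : measurable_fun setT g ->
  measurable [set x | e <= `|g x|].
Proof.
move=> mg; rewrite -[X in measurable X]setTI.
rewrite (_ : [set x | _] = (Num.Def.normr \o g) @^-1` `[e, +oo[%classic); last first.
  by apply/seteqP; split => x /=; rewrite in_itv/= andbT.
by apply: measurableT_comp => //; exact: measurableT_comp.
Qed.

Local Open Scope ereal_scope.

Lemma measurable_L1fun (v : LspaceType1 mu) : measurable_fun setT (L1fun v).
Proof.
exact: (measurable_funPT (repr (v : {mfun_ mu, T >-> measurableTypeR R}))).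
Qed.

Lemma measurable_norm_EFin g : measurable_fun setT g ->
  measurable_fun setT (abse \o (EFin \o g)).
Proof.
by move=> mg; apply/measurable_EFinP; exact: measurableT_comp.
Qed.

(** Needed because [iota] is linear only almost everywhere on representatives. *)
Lemma ae_eq_Lnorm1 g h : measurable_fun setT g -> measurable_fun setT h ->
  g = h %[ae mu] -> 'N[mu]_1[EFin \o g] = 'N[mu]_1[EFin \o h].
Proof.
move=> mg mh gh; rewrite !Lnorm1; apply: ge0_ae_eq_integral => //.
- exact: measurable_norm_EFin.
- exact: measurable_norm_EFin.
- by move: gh; apply: filterS => x /(_ I) gx _ /=; rewrite gx.
Qed.

Lemma Lnorm1Z (a : R) g : measurable_fun setT g ->
  'N[mu]_1[EFin \o (a \*: g)%R] = `|a|%:E * 'N[mu]_1[EFin \o g].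
Proof.
move=> mg; rewrite !Lnorm1.
under eq_integral => x _ do rewrite /= normrM EFinM.
by rewrite ge0_integralZl//; exact: measurable_norm_EFin.
Qed.

Lemma Lnorm1_distC g h :
  'N[mu]_1[EFin \o (g \- h)%R] = 'N[mu]_1[EFin \o (h \- g)%R].
Proof.
by rewrite !Lnorm1; apply: eq_integral => x _ /=; rewrite distrC.
Qed.

Lemma Lnorm1_distD g h k : measurable_fun setT g -> measurable_fun setT h ->
  measurable_fun setT k ->
  'N[mu]_1[EFin \o (g \- k)%R] <=
  'N[mu]_1[EFin \o (g \- h)%R] + 'N[mu]_1[EFin \o (h \- k)%R].
Proof.
move=> mg mh mk.
have -> : (g \- k = (g \- h) \+ (h \- k))%R.
  by apply/funext => x /=; rewrite subrKA.
by apply: eminkowski => //; exact: measurable_funB.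
Qed.

(** Where [e <= |g x|], either [h x != 0] or [e <= |h x - g x|], and Markov's inequality bounds the
    measure of the latter set. *)
Lemma support_le_dist g h (e : R) : (0 < e)%R ->
  measurable_fun setT g -> measurable_fun setT h ->
  e%:E * mu [set x | e <= `|g x|]%R <=
  e%:E * mu [set x | h x != 0%R] + 'N[mu]_1[EFin \o (h \- g)%R].
Proof.
move=> e0 mg mh.
have mhg : measurable_fun setT (h \- g)%R by exact: measurable_funB.
have := le_integral_abse mu measurableT (proj2 (measurable_EFinP _ _) mhg) e0.
rewrite setTI Lnorm1 => markov.
have ms : measurable [set x | h x != 0%R].
  rewrite -[X in measurable X]setTI.
  rewrite (_ : [set x | h x != 0%R] = h @^-1` (~` [set 0%R])); last first.
    by apply/seteqP; split => x /= /eqP.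
  by apply: mh => //; apply: measurableC.
apply: le_trans (leeD2l _ markov).
rewrite -muleDr ?ge0_adde_def ?inE//.
apply: lee_wpmul2l; first by rewrite lee_fin ltW.
apply: (@le_trans _ _
    (mu ([set x | h x != 0%R] `|` [set x | e <= `|(h \- g) x|]%R))).
  apply: le_measure; rewrite ?inE; first exact: measurable_norm_ge.
    by apply: measurableU => //; exact: measurable_norm_ge.
  move=> x /= ex; have [h0|hn0] := eqVneq (h x) 0%R; [right|by left].
  by rewrite /= h0 sub0r normrN.
by apply: measureU2 => //; exact: measurable_norm_ge.
Qed.

(** The level sets at heights [n.+1%:R^-1] increase to the support of [g], so by continuity from
    below it suffices to bound each of them by [c]. *)
Lemma support_lower_semicontinuous g (c : \bar R) : measurable_fun setT g ->
  (forall e : R, (0 < e)%R -> exists2 h : T -> R, measurable_fun setT h &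
     mu [set x | h x != 0%R] <= c /\ 'N[mu]_1[EFin \o (h \- g)%R] <= e%:E) ->
  mu [set x | g x != 0%R] <= c.
Proof.
move=> mg gh.
have level (e : R) : (0 < e)%R -> mu [set x | e <= `|g x|]%R <= c.
  move=> e0; apply/lee_addgt0Pr => r r0.
  (* An [L^1] error of [e * r] becomes [r] once the factor [e] is cancelled. *)
  have [h mh [hc hr]] := gh (e * r)%R (mulr_gt0 e0 r0).
  have c0 : 0 <= c by exact: le_trans (measure_ge0 _ _) hc.
  rewrite -(@lee_pmul2l _ e%:E)// ge0_muleDr ?lee_fin ?(ltW r0)//.
  apply: le_trans (support_le_dist _ _ _ e0 mg mh) _.
  by rewrite leeD// ?EFinM// lee_wpmul2l// lee_fin ltW.
have -> : [set x | g x != 0%R] =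
    \bigcup_n [set x | (n.+1%:R^-1 <= `|g x|)%R].
  apply/seteqP; split => [x /= gx|x [n _] /=]; last first.
    by apply: contraTneq => ->; rewrite normr0 -ltNge.
  have g0 : (0 < `|g x|)%R by rewrite normr_gt0.
  exists (Num.truncn (`|g x|^-1)%R) => //=.
  by rewrite invf_ple ?posrE//; exact/ltW/truncnS_gt.
have mF n : measurable [set x | (n.+1%:R^-1 <= `|g x|)%R].
  exact: measurable_norm_ge.
apply: (cvge_to_le (nondecreasing_cvg_mu mF _ _)).
- exact: bigcup_measurable.
- move=> m n mn; apply/subsetPset => x /=; apply: le_trans.
  by rewrite lef_pV2 ?posrE// ler_nat.
- by apply: nearW => n /=; exact: level.
Qed.

End L1_distance.

(** * Linearity and continuity of the embedding on representatives *)

Section embedding.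
Context {d : measure_display} {T : measurableType d} {R : realType}.
Context (mu : {measure set T -> \bar R}) (X : normedModType R).
Context (iota : X -> LspaceType1 mu) (iota_lin : linear_into_L1 iota).
Implicit Types (u w : X) (k : T -> R).

Lemma L1fun_sub u w :
  L1fun (iota (u - w)) = L1fun (iota u) \- L1fun (iota w) %[ae mu].
Proof.
have := iota_lin (-1) w u; rewrite scaleN1r addrC.
by apply: filterS => x /(_ I) E _; rewrite E /= scaleN1r addrC.
Qed.

Lemma L1fun_dist_le (C : R) u w :
  (forall v, ('N[mu]_1[EFin \o L1fun (iota v)] <= (C * `|v|)%:E)%E) ->
  ('N[mu]_1[EFin \o (L1fun (iota u) \- L1fun (iota w))%R] <=
   (C * `|u - w|)%:E)%E.
Proof.
move=> iotaC; apply: le_trans (iotaC (u - w)).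
rewrite (ae_eq_Lnorm1 _ _ _ _ _ (L1fun_sub u w))//; first exact: measurable_L1fun.
by apply: measurable_funB; exact: measurable_L1fun.
Qed.

(** The map sending [u] to [L1fun (iota u) \- k] is affine almost everywhere, so Minkowski's
    inequality applies. *)
Lemma L1_ball_convex k (e : R) : measurable_fun setT k ->
  convex_subset [set u | ('N[mu]_1[EFin \o (L1fun (iota u) \- k)%R] <= e%:E)%E].
Proof.
move=> mk u w t /andP[t0 t1] /= ue we.
have mL v := measurable_L1fun mu (iota v).
have mB v : measurable_fun setT (L1fun (iota v) \- k) by exact: measurable_funB.
(* This is the shape [a *: u + v] in which [linear_into_L1] is stated. *)
have -> : t *: u + (1 - t) *: w = t *: (u - w) + w.
  by rewrite scalerBr scalerBl scale1r addrA addrAC.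
rewrite (ae_eq_Lnorm1 _ _ ((t \*: (L1fun (iota u) \- k)) \+
    ((1 - t) \*: (L1fun (iota w) \- k)))) //.
- apply: le_trans.
    apply: eminkowski => //; exact: measurable_funM.
  rewrite !Lnorm1Z// !gtr0_norm ?subr_gt0//.
  have -> : e%:E = (t%:E * e%:E + (1 - t)%:E * e%:E)%E.
    by rewrite -!EFinM -EFinD; congr EFin; ring.
  by apply: leeD; apply: lee_wpmul2l => //; rewrite lee_fin ?subr_ge0 ltW.
- by apply: measurable_funD; exact: measurable_funM.
- move: (iota_lin t (u - w) w) (L1fun_sub u w); apply: filterS2 => x.
  move=> /(_ I) E /(_ I) F _; rewrite /= E /= F /=.
  by rewrite /GRing.scale/=; ring.
Qed.

End embedding.

(** * Sublevel sets, coercivity and balls *)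

Section extended_functional.
Context {R : realType} {X : normedModType R}.
Implicit Types f : X -> \bar R.

Lemma sublevel_convex f (a : R) : convex_efun f ->
  convex_subset [set u | (f u <= a%:E)%E].
Proof.
move=> cf u w t /andP[t0 t1] /= fu fw.
apply: le_trans (cf u w t _) _; first by rewrite t0.
have -> : a%:E = (t%:E * a%:E + (1 - t)%:E * a%:E)%E.
  by rewrite -!EFinM -EFinD; congr EFin; ring.
by apply: leeD; apply: lee_wpmul2l => //; rewrite lee_fin ?subr_ge0 ltW.
Qed.

Lemma sublevel_closure f (a : R) (x : X) : lower_semicontinuous f ->
  closure [set u | (f u <= a%:E)%E] x -> (f x <= a%:E)%E.
Proof.
move=> lf cx; rewrite leNgt; apply/negP => /lf[V Vx Va].
by have [y [/= fy /Va]] := cx V Vx; rewrite ltNge fy.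
Qed.

(** An unbounded sequence has terms with [n <= |u (phi n)|], along which [f] would exceed [a]. As
    [coercive] concerns arbitrary sequences, [phi] need not be increasing. *)
Lemma coercive_bounded f (u : X^nat) (a : R) : coercive f ->
  (forall n, (f (u n) <= a%:E)%E) -> exists M : R, forall n, `|u n| <= M.
Proof.
move=> cf fu; apply: contrapT => nb.
have /choice[phi phiP] : forall n : nat, exists k, n%:R <= `|u k|.
  move=> n; apply: contrapT => nk; apply: nb; exists n%:R => k.
  by rewrite leNgt; apply/negP => uk; apply: nk; exists k; exact: ltW.
have : (fun n => `|u (phi n)|) @ \oo --> +oo%R.
  apply/cvgryPge => A; near=> n; apply: le_trans (phiP n).
  by near: n; exact: nbhs_infty_ger.
move=> /(cf (u \o phi)) /cvgeyPge/(_ (a + 1)) H.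
have [n] := filter_ex H.
by rewrite leNgt (le_lt_trans (fu _))// lte_fin ltrDl.
Unshelve. all: by end_near. Qed.

End extended_functional.

Lemma ball_convex {R : realType} {X : normedModType R} (M : R) :
  convex_subset [set u : X | `|u| <= M].
Proof.
move=> u w t /andP[t0 t1] /= uM wM.
apply: le_trans (ler_normD _ _) _; rewrite !normrZ !gtr0_norm ?subr_gt0//.
rewrite [leRHS](_ : _ = t * M + (1 - t) * M); last by ring.
by apply: lerD; apply: ler_wpM2l; rewrite ?subr_ge0// ltW.
Qed.

Lemma exists_natSinv_le {R : realType} (e : R) : 0 < e ->
  exists n : nat, n.+1%:R^-1 <= e.
Proof.
move=> e0; have [n] := filter_ex (near_infty_natSinv_lt (PosNum e0)).
by move=> /= /ltW; exists n.
Qed.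

(** * Existence of a minimizer under the [L^0] constraint *)

Theorem theorem5p2 (R : realType) (d : measure_display) (Omega : measurableType d)
    (mu : {sigma_finite_measure set Omega -> \bar R})
    (K : R) (K_gt0 : 0 < K) (K_lt : (K%:E < mu [set: Omega])%E)
    (X : completeNormedModType R) (X_reflexive : reflexive_space X)
    (iota : X -> LspaceType1 mu) (iota_compact : compact_embedding_L1 iota)
    (f : X -> \bar R) (f_proper : proper_fun f)
    (f_lsc : lower_semicontinuous f) (f_convex : convex_efun f)
    (f_bounded : bounded_below f) (f_coercive : coercive f)
    (u0 : X) (fu0 : (f u0 < +oo)%E) (u0K : (L0norm (iota u0) <= K%:E)%E) :
  exists u : X,
    global_solution f [set v | (L0norm (iota v) <= K%:E)%E] u.
Proof.
have [iota_lin _ [C iotaC] iota_cpt] := iota_compact.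
have mL v := measurable_L1fun mu v.
set A := [set v | _].
have Au0 : A u0 by [].
have m_le v : A v -> (ereal_inf (f @` A) <= f v)%E.
  by move=> Av; apply: ereal_inf_lbound; exists v.
have [m mE] : exists m : R, ereal_inf (f @` A) = m%:E.
  have [b fb] := f_bounded.
  have : (b%:E <= ereal_inf (f @` A))%E by apply: le_ereal_inf_tmp => _ [v _ <-].
  have := le_lt_trans (m_le _ Au0) fu0.
  by case: (ereal_inf _) => [r _ _||//]; [exists r|rewrite ltxx].
have /choice[u uP] : forall n : nat, exists v, A v /\
    (f v <= (m + n.+1%:R^-1)%:E)%E.
  move=> n; have : (ereal_inf (f @` A) < (m + n.+1%:R^-1)%:E)%E.
    by rewrite mE lte_fin ltrDl invr_gt0.
  by move=> /ereal_inf_lt[_ [v Av <-] /ltW fv]; exists v.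
have [|M uM] := coercive_bounded f u (m + 1) f_coercive.
  move=> n; apply: le_trans (uP n).2 _.
  by rewrite lee_fin lerD2l invf_le1// ler1n.
have [phi [v [phi_incr iotav]]] := iota_cpt u (ex_intro _ M uM).
pose w n := u (phi n).
(* The increasing [phi] satisfies [n <= phi n], so the subsequence keeps the rate [n.+1%:R^-1]. *)
have fw n : (f (w n) <= (m + n.+1%:R^-1)%:E)%E.
  apply: le_trans (uP (phi n)).2 _; rewrite lee_fin lerD2l lef_pV2 ?posrE//.
  by rewrite ler_nat ltnS; exact: unstable.mono_leq_infl.
have distw (e : R) : 0 < e -> \forall n \near \oo,
    ('N[mu]_1[EFin \o (L1fun (iota (w n)) \- L1fun v)%R] <= e%:E)%E.
  move=> e0.
  have : nbhs 0%E [set y : \bar R | (y < e%:E)%E].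
    by apply: open_nbhs_nbhs; split;
      [exact: open_ereal_lt_ereal|rewrite /= lte_fin].
  by move=> /iotav iv; near=> n; apply/ltW; near: n; exact: iv.
(* The constraint [A] is left out since it need not be convex; it is recovered from the [w n] at the
   end. *)
pose S n := [set x : X | [/\ (f x <= (m + n.+1%:R^-1)%:E)%E,
  ('N[mu]_1[EFin \o (L1fun (iota x) \- L1fun v)%R] <= (n.+1%:R^-1)%:E)%E &
  `|x| <= M]].
have natSV (i j : nat) : (i <= j)%N -> j.+1%:R^-1 <= i.+1%:R^-1 :> R.
  by move=> ij; rewrite lef_pV2 ?posrE// ler_nat.
have [x xS] : exists x, forall n, closure (S n) x.
  apply: (smulian S M X_reflexive).
  - move=> n a b t t01 [fa da Ma] [fb db Mb]; split.
    + exact: (sublevel_convex f _ f_convex).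
    + exact: (L1_ball_convex mu X iota iota_lin).
    + exact: ball_convex.
  - move=> n; have n0 : 0 < n.+1%:R^-1 :> R by rewrite invr_gt0.
    have [k [/= nk kd]] := filter_ex (filterI (nbhs_infty_ge n) (distw _ n0)).
    exists (w k); split=> //; last exact: uM.
    by apply: le_trans (fw k) _; rewrite lee_fin lerD2l natSV.
  - move=> i j ij a [fa da Ma]; split=> //.
    + by apply: le_trans fa _; rewrite lee_fin lerD2l natSV.
    + by apply: le_trans da _; rewrite lee_fin natSV.
  - by move=> a [].
have fx : (f x <= m%:E)%E.
  apply/lee_addgt0Pr => e /exists_natSinv_le[n ne].
  apply: (@le_trans _ _ (m + n.+1%:R^-1)%:E); last by rewrite lee_fin lerD2l.
  apply: sublevel_closure => //; apply: closure_subset (xS n).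
  by move=> a [].
(* In effect [iota x = v]: some [y] in [S n] is close to [x] in [X], hence in [L^1] by continuity of
   [iota], and [y] is close to [v] in [L^1]. *)
have dx (e : R) : 0 < e ->
    ('N[mu]_1[EFin \o (L1fun v \- L1fun (iota x))%R] <= e%:E)%E.
  move=> e0; have e2 : 0 < e / 2 by rewrite divr_gt0.
  (* [C] may be nonpositive, hence this positive majorant. *)
  have C0 : 0 < `|C| + 1 by rewrite ltr_wpDl.
  have [n ne] := exists_natSinv_le _ e2.
  have [y [[_ dy _]]] := xS n _ (nbhsx_ballx x _ (divr_gt0 e2 C0)).
  rewrite -ball_normE /= => xy.
  apply: le_trans (Lnorm1_distD _ _ (L1fun (iota y)) _ _ _ _) _ => //.
  rewrite (splitr e) EFinD; apply: leeD.
    by rewrite Lnorm1_distC (le_trans dy)// lee_fin.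
  rewrite Lnorm1_distC; apply: le_trans (L1fun_dist_le _ _ _ iota_lin C _ _ iotaC) _.
  rewrite lee_fin; apply: le_trans (_ : (`|C| + 1) * `|x - y| <= _).
    by rewrite ler_wpM2r// (le_trans (ler_norm C))// lerDl.
  by rewrite mulrC -ler_pdivlMr// ltW.
exists x; split=> [|y Ay]; last by apply: le_trans fx _; rewrite -mE; exact: m_le.
(* The [w k] are admissible and, by way of [v], approximate [iota x] in [L^1], so the support bound
   passes to [x]. *)
apply: support_lower_semicontinuous (mL _) _ => e e0.
have e2 : 0 < e / 2 by rewrite divr_gt0.
have [k kd] := filter_ex (distw _ e2).
exists (L1fun (iota (w k))) => //; split; first exact: (uP (phi k)).1.
apply: le_trans (Lnorm1_distD _ _ (L1fun v) _ _ _ _) _ => //.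
by rewrite (splitr e) EFinD leeD// dx.
Unshelve. all: by end_near. Qed.
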